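(* Let $\Sigma$ be a finite alphabet with at least two symbols. There is no algorithm with oracle access which, for every almost periodic sequence $\omega\in\Sigma^{\mathbb{N}}$ and every almost periodicity regulator $f$ of $\omega$, given oracle access to $\omega$ and $f$, halts and correctly decides whether $\omega$ is eventually strongly almost periodic.
   Context: For a sequence $\omega$, write $\omega[i,j]=\omega(i)\dots\omega(j)$ and $\omega[i,\infty)$ for the suffix starting at $i$; a factor is a nonempty string $\omega[i,j]$. A sequence is almost periodic if for every factor $x$ occurring in it infinitely many times there is $l$ such that every factor of length $l$ contains an occurrence of $x$. It is strongly almost periodic if this holds for every factor $x$; it is eventually strongly almost periodic if some suffix is strongly almost periodic. A function $r\colon\mathbb{N}\to\mathbb{N}$ is an almost periodicity regulator of an almost periodic $\omega$ if (1) every string of length $k$ occurring in $\omega$ infinitely many times occurs in every factor of $\omega$ of length $r(k)$, and (2) every string of length $k$ occurring in $\omega$ only finitely many times does not occur in $\omega[r(k),\infty)$. An algorithm with oracle access to $\omega$ and $f$ may query values $\omega(i)$ and $f(i)$. *)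

(* Defs.v *)
From mathcomp Require Import all_boot.

Set Implicit Arguments.
Unset Strict Implicit.
Unset Printing Implicit Defensive.

Section Sequences.
Variable Sigma : finType.
Implicit Types (om : nat -> Sigma) (x : seq Sigma) (i k l n : nat).

(* The window of length k at position i: om[i, i + k - 1]; empty for k = 0. *)
Definition window om i k : seq Sigma := mkseq (fun t => om (i + t)) k.

Definition suffix_from om n : nat -> Sigma := fun t => om (n + t).

Definition occurs_at om x i : Prop := window om i (size x) = x.

Definition is_factor om x : Prop := x <> [::] /\ exists i, occurs_at om x i.

Definition occurs_infinitely om x : Prop :=
  forall N, exists2 i, N <= i & occurs_at om x i.

(* No nonempty x is an infix of the empty window, so l = 0 is not a degenerate
   witness. *)
Definition in_every_window om x l : Prop := forall i, infix x (window om i l).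

Definition almost_periodic om : Prop :=
  forall x, is_factor om x -> occurs_infinitely om x ->
  exists l, in_every_window om x l.

Definition strongly_almost_periodic om : Prop :=
  forall x, is_factor om x -> exists l, in_every_window om x l.

Definition eventually_strongly_almost_periodic om : Prop :=
  exists n, strongly_almost_periodic (suffix_from om n).

Definition regulator om (f : nat -> nat) : Prop :=
  forall k x, size x = k ->
    (occurs_infinitely om x -> in_every_window om x (f k)) /\
    (~ occurs_infinitely om x -> forall i, f k <= i -> ~ occurs_at om x i).

End Sequences.

(* Algorithms with two function oracles are register machines: a program is a
   finite list of instructions acting on registers that hold natural numbers.
   The instructions Inc and DecJz alone already compute all partial recursive
   functions. *)
Inductive instr : Type :=
| Inc (r : nat)
| DecJz (r l : nat)      (* if r holds 0 jump to l, else decrement r *)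
| QueryA (r s : nat)     (* r := a(contents of s) *)
| QueryB (r s : nat).    (* r := b(contents of s) *)

Definition program : Type := seq instr.

(* Program counter and register contents. *)
Definition config : Type := (nat * (nat -> nat))%type.

Definition set_reg (reg : nat -> nat) (r v : nat) : nat -> nat :=
  fun s => if s == r then v else reg s.

Definition exec (a b : nat -> nat) (c : config) (ins : instr) : config :=
  let: (pc, reg) := c in
  match ins with
  | Inc r => (pc.+1, set_reg reg r ((reg r).+1))
  | DecJz r l =>
      if reg r == 0 then (l, reg) else (pc.+1, set_reg reg r ((reg r).-1))
  | QueryA r s => (pc.+1, set_reg reg r (a (reg s)))
  | QueryB r s => (pc.+1, set_reg reg r (b (reg s)))
  end.

Definition step (a b : nat -> nat) (p : program) (c : config) : config :=
  if onth p c.1 is Some ins then exec a b c ins else c.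

(* The machine starts at instruction 0 with all registers 0, halts when the
   program counter leaves the program, and its output is then register 0. *)
Definition run (a b : nat -> nat) (p : program) (t : nat) : config :=
  iter t (step a b p) (0, fun=> 0).

Definition halts_with (a b : nat -> nat) (p : program) (y : nat) : Prop :=
  exists t, size p <= (run a b p t).1 /\ (run a b p t).2 0 = y.

(* Letters are handed to the machine as their index in the enumeration of the
   alphabet. *)
Definition letter_oracle (Sigma : finType) (om : nat -> Sigma) : nat -> nat :=
  fun i => enum_rank (om i).

(* The answers yes and no are the outputs 1 and 0. *)
Definition decides_on (Sigma : finType) (p : program) (om : nat -> Sigma)
    (f : nat -> nat) (P : Prop) : Prop :=
  exists b : bool, halts_with (letter_oracle om) f p b /\ (b <-> P).

(* Main.v *)
(** Period-doubling with defects: the letter at position [m >= 1] is the parity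
    of the 2-adic valuation of [m], except that it is forced to be 1 at
    [m = 2 ^ e] when [e] lies in a set [S].  A window of length at most [2 ^ n]
    far from the origin meets only one multiple of [2 ^ n], so it is determined
    by its position modulo [2 ^ n] and by the letter at that multiple, and both
    letters occur there with bounded gaps away from the defects.  Hence one
    function is a regulator for every [S] simultaneously.  If [S] is bounded, a
    suffix is recurrent; if [S] is everything, every defect at an even [e] lies
    in a word that never recurs.  A halting computation reads only a prefix,
    which does not tell the two cases apart. *)
Require Import Defs.
From mathcomp Require Import all_boot zify.

Set Implicit Arguments.
Unset Strict Implicit.
Unset Printing Implicit Defensive.

(** * Valuations and residues *)

Lemma logn2_double_odd n s : logn 2 (2 ^ n * s.*2.+1) = n.
Proof.
rewrite lognM ?expn_gt0 // pfactorK // logn_coprime ?addn0 //.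
by rewrite coprime2n /= odd_double.
Qed.

Lemma logn_eq_mod p n m1 m2 : prime p -> m1 = m2 %[mod p ^ n] ->
  ~~ (p ^ n %| m1) -> logn p m1 = logn p m2.
Proof.
move=> p_pr.
wlog le12 : m1 m2 / logn p m1 <= logn p m2 => [hw|eqm ndvd].
  move=> eqm ndvd; case/orP: (leq_total (logn p m1) (logn p m2)) => le.
    exact: hw.
  by apply/esym/hw; rewrite // /dvdn -eqm.
have m1_gt0 : 0 < m1 by case: (m1) ndvd => //; rewrite dvdn0.
have m2_gt0 : 0 < m2 by case: (m2) eqm ndvd => //; rewrite /dvdn => ->; rewrite mod0n.
apply/eqP; rewrite eqn_leq le12 /= -pfactor_dvdn //.
have le2n : logn p m2 <= n.
  case: leqP => // lt_n2.
  have : p ^ n %| m2 by rewrite pfactor_dvdn // ltnW.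
  by rewrite /dvdn -eqm -/(p ^ n %| m1) (negbTE ndvd).
have dvdn2 : p ^ logn p m2 %| p ^ n by rewrite dvdn_exp2l.
by rewrite /dvdn -(modn_dvdm m1 dvdn2) eqm modn_dvdm // -/(dvdn _ _) pfactor_dvdnn.
Qed.

(** * Windows and occurrences *)

Section Windows.
Variable T : finType.
Implicit Types (om : nat -> T) (x : seq T).

Lemma occurs_atP (x0 : T) om x i :
  occurs_at om x i <-> forall d, d < size x -> om (i + d) = nth x0 x d.
Proof.
split=> [occ d ltd | eqx]; first by rewrite -occ nth_mkseq.
apply: (@eq_from_nth _ x0) => [|d]; rewrite size_mkseq // => ltd.
by rewrite nth_mkseq // eqx.
Qed.

Lemma window_cat om i k l : window om i (k + l) = window om i k ++ window om (i + k) l.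
Proof.
rewrite /window /mkseq iotaD map_cat add0n -[in iota k l](addn0 k) iotaDl -map_comp.
by congr cat; apply: eq_map => t /=; rewrite addnA.
Qed.

Lemma infix_window om x i l j : i <= j -> j + size x <= i + l ->
  occurs_at om x j -> infix x (window om i l).
Proof.
move=> leij lejl occ; apply/infixP.
have [r eql] : exists r, l = (j - i) + (size x + r).
  by exists (i + l - (j + size x)); lia.
exists (window om i (j - i)), (window om (j + size x) r).
by rewrite eql !window_cat subnKC // occ.
Qed.

Lemma infix_window_occurs om x i l : infix x (window om i l) ->
  exists2 j, i <= j & occurs_at om x j.
Proof.
case/infixP=> p [s eqw]; exists (i + size p); first exact: leq_addr.
have := congr1 size eqw; rewrite size_mkseq !size_cat => eql.
move: eqw; rewrite eql !window_cat => /eqP.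
rewrite eqseq_cat ?size_mkseq // => /andP[_].
by rewrite eqseq_cat ?size_mkseq // => /andP[/eqP ? _].
Qed.

Lemma in_every_window_occurs_infinitely om x l :
  in_every_window om x l -> occurs_infinitely om x.
Proof. by move=> inw N; apply: infix_window_occurs (inw N). Qed.

Lemma regulator_almost_periodic om f : regulator om f -> almost_periodic om.
Proof. by move=> reg x _ inf; exists (f (size x)); apply: (reg _ x erefl).1. Qed.

Lemma window_suffix om n i k : window (suffix_from om n) i k = window om (n + i) k.
Proof. by apply: eq_map => t; rewrite /suffix_from addnA. Qed.

Lemma occurs_at_suffix om n x i :
  occurs_at (suffix_from om n) x i <-> occurs_at om x (n + i).
Proof. by rewrite /occurs_at window_suffix. Qed.

End Windows.

(** * Finite use of an oracle *)

Section Oracles.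
Variables (b : nat -> nat) (p : program).

Lemma run_halted a t u : size p <= (run a b p t).1 -> t <= u ->
  run a b p u = run a b p t.
Proof.
move=> halt /subnK <-; elim: (u - t) => // d IHd.
by rewrite /run addSn iterS -/(run a b p _) IHd /step onth_default.
Qed.

Lemma halts_with_uniq a y z : halts_with a b p y -> halts_with a b p z -> y = z.
Proof.
move=> [t [ht <-]] [u [hu <-]].
by case/orP: (leq_total t u) => le; rewrite (run_halted _ le).
Qed.

(** Induction on [t]: one step makes at most one query to [a], and [N'] lies just past the queried
    position. *)
Lemma run_use a t : exists N, forall a', (forall i, i < N -> a' i = a i) ->
  run a' b p t = run a b p t.
Proof.
elim: t => [|t [N IHN]]; first by exists 0.
pose N' := if onth p (run a b p t).1 is Some (QueryA _ s)
           then ((run a b p t).2 s).+1 else 0.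
exists (maxn N N') => a' agree.
have -> : run a' b p t.+1 = step a' b p (run a b p t).
  by rewrite -(IHN a') // => i lt; apply: agree; rewrite leq_max lt.
rewrite /run iterS -/(run a b p t) /step; move: agree; rewrite /N'.
case: (onth p _) => [[] |] //; case: (run a b p t) => pc reg //= r s agree.
by rewrite agree // leq_max ltnSn orbT.
Qed.

Lemma halts_with_use a y : halts_with a b p y ->
  exists N, forall a', (forall i, i < N -> a' i = a i) -> halts_with a' b p y.
Proof.
case=> t [halt out]; have [N useN] := run_use a t.
by exists N => a' /useN eqr; exists t; rewrite eqr.
Qed.

End Oracles.

(** * Sequences with defects *)

Definition defect_bit (S : pred nat) (m : nat) : bool :=
  odd (logn 2 m) || (m == 2 ^ logn 2 m) && S (logn 2 m).

Lemma defect_bit_not_pow S m : m != 2 ^ logn 2 m -> defect_bit S m = odd (logn 2 m).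
Proof. by rewrite /defect_bit => /negbTE ->; rewrite orbF. Qed.

Lemma defect_bit_pred0 m : defect_bit pred0 m = odd (logn 2 m).
Proof. by rewrite /defect_bit andbF orbF. Qed.

Lemma not_pow2 n m : 2 ^ n < m -> ~~ (2 ^ n %| m) -> m != 2 ^ logn 2 m.
Proof.
move=> lt; apply: contra => /eqP eqm; rewrite eqm dvdn_exp2l //.
by move: lt; rewrite {1}eqm ltn_exp2l // => /ltnW.
Qed.

Lemma defect_bit_odd_multiple S n s : defect_bit S (2 ^ n * s.+1.*2.+1) = odd n.
Proof.
rewrite defect_bit_not_pow logn2_double_odd // -{2}[2 ^ n]muln1 eqn_pmul2l //.
by rewrite expn_gt0.
Qed.

Section Letters.
Variables (T : finType) (a0 a1 : T).

Definition defect_seq (S : pred nat) (i : nat) : T :=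
  if defect_bit S i.+1 then a1 else a0.

(** The factor 16 is 8 + 8: a window first reaches a multiple of [2 ^ k * 8], then covers a whole
    block of that length. *)
Definition defect_reg (k : nat) : nat := 2 ^ k * 16.

(** Taking [S' = S] gives the regulator; taking [S'] empty moves a word into the sequence without
    defects. *)
Lemma defect_seq_window S S' x i : 2 ^ size x <= i ->
  occurs_at (defect_seq S) x i ->
  in_every_window (defect_seq S') x (defect_reg (size x)).
Proof.
move=> lei occ i'; rewrite /defect_reg.
set n := size x in lei *; set P := 2 ^ n in lei *.
have P_gt0 : 0 < P by rewrite expn_gt0.
have ltnP : n < P by rewrite ltn_expl.
(* As [n < P], this is the only multiple of [P] that the positions [i + 1] to [i + n] can meet. *)
pose c := defect_bit S (P * (i %/ P).+1).
pose t := (i' %/ (P * 8)).+1.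
(* The two choices give the multiples P * (8t+3) and P * (8t+6), of
   valuations n and n+1, neither of which is a power of 2. *)
pose s := 8 * t + 2 + (if c == odd n then 0 else 3).
have bit_s : defect_bit S' (P * s.+1) = c.
  rewrite /s; case: eqP => [-> | /eqP nc].
    have -> : (8 * t + 2 + 0).+1 = (4 * t).+1.*2.+1 by lia.
    exact: defect_bit_odd_multiple.
  have -> : P * (8 * t + 2 + 3).+1 = 2 ^ n.+1 * (2 * t).+1.*2.+1.
    by rewrite expnS -/P; nia.
  by rewrite defect_bit_odd_multiple /=; case: (c) (odd n) nc => [] [].
have s_bounds : 8 * t + 2 <= s <= 8 * t + 5 by rewrite /s; case: ifP; lia.
have div_i' := divn_eq i' (P * 8).
have mod_i' : i' %% (P * 8) < P * 8 by rewrite ltn_mod; lia.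
have div_i := divn_eq i P; have mod_i : i %% P < P by rewrite ltn_mod.
pose q := P * s + i %% P.
apply: (@infix_window _ _ _ _ _ q); rewrite -/n.
- by rewrite /q /t in s_bounds *; nia.
- by rewrite /q /t in s_bounds *; nia.
apply/(occurs_atP a0) => d ltd; rewrite -((occurs_atP a0 _ _ _).1 occ d ltd).
have ltdP : d < P by apply: ltn_trans ltnP.
rewrite /defect_seq; congr (if _ then _ else _).
have eqmod : (q + d).+1 = (i + d).+1 %[mod P].
  by rewrite /q -!addnS -addnA mulnC modnMDl modnDml.
have P_lt_q : P < (q + d).+1 by rewrite /q; nia.
have P_lt_i : P < (i + d).+1 by lia.
have [dvd|ndvd] := boolP (P %| (i + d).+1).
  have eq_d : i %% P + d.+1 = P.
    move: dvd; rewrite -addnS {1}div_i -addnA dvdn_addr ?dvdn_mull //.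
    by case/dvdnP=> [[|[|u]]]; nia.
  have -> : (i + d).+1 = P * (i %/ P).+1 by lia.
  have -> : (q + d).+1 = P * s.+1 by rewrite /q; lia.
  by rewrite bit_s.
(* Past [P], a non-multiple of [P] is no power of 2, and its valuation depends only on its residue
   modulo [P]. *)
have ndvd_q : ~~ (P %| (q + d).+1) by rewrite /dvdn eqmod.
rewrite !defect_bit_not_pow ?(@not_pow2 n) //; congr odd.
exact: (@logn_eq_mod 2 n).
Qed.

(** For the second clause: a single occurrence at [2 ^ k] or later already forces infinitely
    many. *)
Lemma defect_seq_regulator S : regulator (defect_seq S) defect_reg.
Proof.
move=> k x <-; split=> [inf | ninf i lei occ].
  by have [i lei occ] := inf (2 ^ size x); apply: defect_seq_window lei occ.
apply/ninf/in_every_window_occurs_infinitely/(defect_seq_window _ _ occ).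
by apply: leq_trans lei; rewrite leq_pmulr.
Qed.

Lemma defect_seq_bounded S N : (forall e, N <= e -> ~~ S e) ->
  eventually_strongly_almost_periodic (defect_seq S).
Proof.
move=> boundS; exists (2 ^ N) => x [_ [i /occurs_at_suffix occ]].
exists (defect_reg (size x)) => i'; rewrite window_suffix.
(* [2 ^ M] exceeds every position in the occurrence, so adding it preserves their valuations; it
   also passes the threshold [2 ^ size x]. *)
pose M := 2 ^ N + i + size x.
have ltM : M < 2 ^ M by apply: ltn_expl.
have leM : 2 ^ size x <= 2 ^ M by rewrite leq_exp2l // leq_addl.
(* There are no defects beyond 2 ^ N, so x recurs after a shift by 2 ^ M. *)
apply: (@defect_seq_window pred0 S x (2 ^ M + (2 ^ N + i))).
  exact: leq_trans leM (leq_addr _ _).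
apply/(occurs_atP a0) => d ltd; rewrite -((occurs_atP a0 _ _ _).1 occ d ltd).
rewrite /defect_seq -addnA -addnS; set m := (2 ^ N + i + d).+1.
have ltm : m < 2 ^ M by rewrite /m; rewrite /M in ltM *; lia.
congr (if _ then _ else _); rewrite defect_bit_pred0.
have -> : logn 2 (2 ^ M + m) = logn 2 m.
  apply/esym/(@logn_eq_mod 2 M) => //; first by rewrite modnDl.
  by rewrite gtnNdvd.
have [eqm|nem] := eqVneq m (2 ^ logn 2 m); last by rewrite defect_bit_not_pow.
rewrite /defect_bit (negbTE (boundS _ _)) ?andbF ?orbF //.
by rewrite -(@leq_exp2l 2) // -eqm /m; lia.
Qed.

(** Position [m] is stored at index [m - 1], so the word starts exactly at the defect [2 ^ j.*2],
    whose exponent is even. *)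
Definition defect_word j : seq T :=
  window (defect_seq predT) (2 ^ j.*2).-1 (2 ^ j.*2 * 3).

(* Comparing letters at two consecutive positions of valuation e in the word
   shows by induction on e that an occurrence is aligned modulo 2 ^ (2j); then
   the letters at 0 and 2 ^ (2j), both equal to 1, are contradictory. *)
Lemma defect_word_not_pure j i : a0 != a1 ->
  ~ occurs_at (defect_seq pred0) (defect_word j) i.
Proof.
move=> neq01; rewrite /occurs_at /defect_word size_mkseq => eqw.
set Q := 2 ^ j.*2 in eqw.
have Q_gt0 : 0 < Q by rewrite expn_gt0.
have bitE d : d < Q * 3 -> odd (logn 2 (i.+1 + d)) = defect_bit predT (Q + d).
  move=> ltd; have := congr1 (fun w => nth a0 w d) eqw.
  rewrite !nth_mkseq // /defect_seq defect_bit_pred0 -!addSn prednK //.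
  by case: odd (defect_bit _ _) => [] [] //= eq01; rewrite eq01 eqxx in neq01.
have level e u : e < j.*2 -> u <= 1 ->
    odd (logn 2 (i.+1 + 2 ^ e * u.*2.+1)) = odd e.
  move=> lte leu; have [c eqQ] : exists c, Q = 2 ^ e * c.+1.*2.
    exists (2 ^ (j.*2 - e.+1)).-1; rewrite prednK ?expn_gt0 //.
    by rewrite -muln2 -expnSr -expnD /Q; congr (2 ^ _); lia.
  have e_gt0 : 0 < 2 ^ e by rewrite expn_gt0.
  rewrite bitE; last by rewrite eqQ; nia.
  rewrite eqQ -mulnDr.
  have -> : c.+1.*2 + u.*2.+1 = (c + u).+1.*2.+1 by lia.
  exact: defect_bit_odd_multiple.
have aligned e : e <= j.*2 -> 2 ^ e %| i.+1.
  elim: e => [|e IHe] lte; first by rewrite dvd1n.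
  have [v eqv] := dvdnP (IHe (ltnW lte)).
  have [odd_v|even_v] := boolP (odd v); last first.
    by rewrite eqv -(even_halfK even_v) expnS -muln2 -mulnA dvdn_mull.
  (* One of [v + 1] and [v + 3] is 2 modulo 4, which yields valuation [e + 1], of the wrong parity
     for [level]. *)
  have [w [u [leu eqw2]]] : exists w u, u <= 1 /\ v + u.*2.+1 = w.*2.+1.*2.
    exists (v.+1./2./2), (~~ odd v.+1./2).
    have := odd_double_half v; have := odd_double_half v.+1./2.
    by case: odd => /=; lia.
  have := level e u lte leu.
  rewrite eqv mulnC -mulnDr eqw2 -mul2n mulnA -expnSr logn2_double_odd /=.
  by case: odd.
have [v eqv] := dvdnP (aligned _ (leqnn _)).
have bit0 : odd (logn 2 i.+1).
  rewrite -[i.+1]addn0 bitE ?addn0; last by rewrite muln_gt0 Q_gt0.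
  by rewrite /defect_bit pfactorK // eqxx orbT.
have bitQ : odd (logn 2 (i.+1 + Q)).
  rewrite bitE; last by lia.
  rewrite /defect_bit addnn -mul2n -expnS pfactorK //=.
  by rewrite odd_double.
(* Either [i.+1] or [i.+1 + Q] is an odd multiple of [Q], hence has even valuation. *)
have [odd_v|even_v] := boolP (odd v).
  move: bit0; rewrite eqv mulnC -(odd_double_half v) odd_v add1n.
  by rewrite logn2_double_odd odd_double.
move: bitQ; rewrite eqv addnC -mulSn mulnC -(even_halfK even_v).
by rewrite logn2_double_odd odd_double.
Qed.

(** A recurrent suffix from [N] would repeat [defect_word N] far out, hence also in the sequence
    without defects. *)
Lemma defect_seq_full : a0 != a1 ->
  ~ eventually_strongly_almost_periodic (defect_seq predT).
Proof.
move=> neq01 [N sap].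
have ltN : N < 2 ^ N.*2.
  by apply: leq_ltn_trans (ltn_expl _ _); rewrite // -addnn leq_addr.
have size_w : size (defect_word N) = 2 ^ N.*2 * 3 by rewrite size_mkseq.
have [|l /in_every_window_occurs_infinitely inf] := sap (defect_word N).
  split; first by move/(congr1 size); rewrite size_w /=; lia.
  exists ((2 ^ N.*2).-1 - N); apply/occurs_at_suffix.
  by rewrite subnKC /occurs_at ?size_w //; lia.
have [i lei /occurs_at_suffix occ] := inf (2 ^ size (defect_word N)).
have inw := defect_seq_window pred0 (leq_trans lei (leq_addl _ _)) occ.
have [i' _ occ'] := in_every_window_occurs_infinitely inw 0.
exact: defect_word_not_pure occ'.
Qed.

(** A power of two that is at most [N < 2 ^ N] has exponent below [N]. *)
Lemma defect_seq_agree N i : i < N ->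
  defect_seq (fun e => e < N) i = defect_seq predT i.
Proof.
move=> ltN; rewrite /defect_seq; congr (if _ then _ else _); congr (_ || _).
case: eqP => //= eqi; rewrite -(@ltn_exp2l 2) // -eqi.
exact: leq_ltn_trans ltN (ltn_expl _ _).
Qed.

End Letters.

Theorem theorem7 (Sigma : finType) (card_Sigma : 2 <= #|Sigma|) :
  ~ exists p : program,
      forall (om : nat -> Sigma) (f : nat -> nat),
        almost_periodic om -> regulator om f ->
        decides_on p om f (eventually_strongly_almost_periodic om).
Proof.
case=> p decide.
have [a0 [a1 [_ _ neq01]]] := card_gt1P card_Sigma.
have decided S : decides_on p (defect_seq a0 a1 S) defect_reg
    (eventually_strongly_almost_periodic (defect_seq a0 a1 S)).
  apply: decide; last exact: defect_seq_regulator.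
  exact: regulator_almost_periodic (defect_seq_regulator a0 a1 S).
have [[] [halt_full full_iff]] := decided predT.
  by apply: (defect_seq_full neq01); apply/full_iff.
(* The regulator oracle is common to both sequences, so only the queried letters could separate
   them. *)
have [N useN] := halts_with_use halt_full.
have [b [halt_N N_iff]] := decided (fun e => e < N).
have b_true : b.
  by apply/N_iff/(@defect_seq_bounded _ _ _ _ N) => e; rewrite -leqNgt.
have /useN halt_N' : forall i, i < N ->
    letter_oracle (defect_seq a0 a1 (fun e => e < N)) i =
    letter_oracle (defect_seq a0 a1 predT) i.
  by move=> i ltN; rewrite /letter_oracle defect_seq_agree.
by have := halts_with_uniq halt_N halt_N'; rewrite b_true.
Qed.
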